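(* Let $X$ be a nonreflexive $M$-embedded Banach space. Then there exists a predual $Y$ of $X^*$ (that is, a Banach space $Y$ with $Y^*$ isometrically isomorphic to $X^*$) such that $Y$ is not Hahn-Banach smooth.
   Context: A closed subspace $Y$ of a Banach space $X$ is an $M$-ideal in $X$ if there exists a subspace $Z$ of $X^*$ such that $X^*=Y^\perp\oplus_{\ell_1}Z$ (i.e. $X^*$ is the direct sum and $\|u+z\|=\|u\|+\|z\|$ for $u\in Y^\perp$, $z\in Z$), where $Y^\perp$ is the annihilator of $Y$ in $X^*$. $X$ is $M$-embedded if its canonical image in $X^{**}$ is an $M$-ideal in $X^{**}$. A Banach space $Y$ is Hahn-Banach smooth if every $y^*\in Y^*$ has a unique norm-preserving linear extension from $Y$ (canonically embedded in $Y^{**}$) to $Y^{**}$. *)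

(* Defs.v *)
From HB Require Import structures.
From mathcomp Require Import all_boot all_order all_algebra.
From mathcomp Require Import complex.
From mathcomp Require Import all_classical all_reals all_analysis.
Import Order.TTheory GRing.Theory Num.Theory.
Import numFieldNormedType.Exports.

Set Implicit Arguments.
Unset Strict Implicit.
Unset Printing Implicit Defensive.

Local Open Scope classical_set_scope.
Local Open Scope ring_scope.
Local Open Scope complex_scope.

(* Banach spaces are taken over either of the two classical scalar fields. *)
Variant scalar_kind := RealScalars | ComplexScalars.

Definition scalar_field (R : realType) (k : scalar_kind) : numFieldType :=
  match k with
  | RealScalars => R
  | ComplexScalars => R[i]
  end.

(* In a numFieldType every element comparable to 0 is real; for complex
   scalars this is the only part of the field that has suprema. *)
Lemma scalar_supremums (R : realType) (k : scalar_kind)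
    (A : set (scalar_field R k)) :
  A !=set0 -> ubound A !=set0 -> (forall a, A a -> 0 <= a) ->
  supremums A !=set0.
Proof.
case: k A => /= A A0 [u uA] Age0.
  exists (sup A); split; first by apply: ub_le_sup; exists u.
  by move=> v vA; exact: ge_sup.
have ReA : has_sup [set complex.Re a | a in A].
  split; first by case: A0 => a Aa; exists (complex.Re a), a.
  exists (complex.Re u) => _ [a Aa <-].
  by have := uA _ Aa; rewrite lecE => /andP[].
exists (sup [set complex.Re a | a in A])%:C; split.
  move=> a Aa; rewrite lecE/=.
  have := Age0 _ Aa; rewrite lecE/= => /andP[/eqP -> _]; rewrite eqxx/=.
  by apply: ub_le_sup; [case: ReA | exists a].
move=> v vA; rewrite lecE/=; apply/andP; split.
  case: A0 => a Aa; have := le_trans (Age0 _ Aa) (vA _ Aa).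
  by rewrite lecE/= => /andP[].
apply: ge_sup; first by case: ReA.
by move=> _ [a Aa <-]; have := vA _ Aa; rewrite lecE => /andP[].
Qed.

Section Dual.
Variables (R : realType) (k : scalar_kind).
Local Notation K := (scalar_field R k).
Variable X : normedModType K.

Definition dual_pred : {pred X -> K^o} :=
  [pred f : X -> K^o | `[< linear f /\ continuous f >]].

Record dual := Dual { dual_fun :> X -> K^o; _ : dual_fun \in dual_pred }.

HB.instance Definition _ := [isSub for dual_fun].
HB.instance Definition _ := [Choice of dual by <:].

Lemma dual_submod_closed : submod_closed dual_pred.
Proof.
split=> [|a f g].
  apply/asboolP; split; last by move=> x; exact: cst_continuous.
  by move=> a x y /=; rewrite scaler0 addr0.
move=> fP gP; apply/asboolP.
have [lf cf] : linear f /\ continuous f by exact/asboolP.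
have [lg cg] : linear g /\ continuous g by exact/asboolP.
split.
  move=> b x y; rewrite !fctE lf lg.
  by rewrite /GRing.scale/= !mulrDr !mulrA [a * b]mulrC addrACA.
move=> x; apply: (@continuousD _ _ _ (a \*: f) g x); last exact: cg.
by apply: continuousZl_tmp; exact: cf.
Qed.
HB.instance Definition _ :=
  GRing.isSubmodClosed.Build K (X -> K^o) dual_pred dual_submod_closed.
HB.instance Definition _ := [SubChoice_isSubLmodule of dual by <:].

Lemma dual_linear (f : dual) : linear f.
Proof. by have /asboolP[] := valP f. Qed.

Lemma dual_continuous (f : dual) : continuous f.
Proof. by have /asboolP[] := valP f. Qed.

HB.instance Definition _ (f : dual) :=
  GRing.isLinear.Build K X K^o *:%R f (@dual_linear f).

Lemma dualP (f g : dual) : f =1 g -> f = g.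
Proof. by move=> fg; apply/val_inj/funext. Qed.

Lemma dualD (f g : dual) x : (f + g) x = f x + g x. Proof. by []. Qed.

Lemma dualZ a (f : dual) x : (a *: f) x = a * f x. Proof. by []. Qed.

(* The norm of a normedModType K takes its values in K itself, so the operator
   norm is the supremum, for the order of K, of a set of nonnegative elements. *)
Definition opnorm (f : dual) : K :=
  supremum 0 [set (`|f x| : K) | x in [set x : X | `|x| <= 1]].

Lemma opnorm_supremums (f : dual) :
  supremums [set (`|f x| : K) | x in [set x : X | `|x| <= 1]] (opnorm f).
Proof.
set A := [set _ | _ in _].
have A0 : A !=set0 by exists `|f 0|, 0 => //=; rewrite normr0.
suff [s sA] : supremums A !=set0.
  by rewrite /opnorm /supremum -/A ifF;
    [apply: xgetPex; exists s | exact/negbTE/set0P].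
apply: scalar_supremums => //; last by move=> _ [x _ <-].
have := @continuous_linear_bounded _ _ _ 0 f (@dual_continuous f 0).
move=> /linear_boundedP/pinfty_ex_gt0[M M0 Mf].
exists M => _ [x x1 <-].
by rewrite (le_trans (Mf _))// ler_piMr// ltW.
Qed.

Lemma opnorm_ub (f : dual) x : `|x| <= 1 -> `|f x| <= opnorm f.
Proof.
by move=> x1; have [ub _] := opnorm_supremums f; apply: ub; exists x.
Qed.

Lemma opnorm_ge0 (f : dual) : 0 <= opnorm f.
Proof.
have : `|f 0| <= opnorm f by apply: opnorm_ub; rewrite normr0.
by rewrite linear0 normr0.
Qed.

Lemma opnormP (f : dual) x : `|f x| <= opnorm f * `|x|.
Proof.
have [->|x0] := eqVneq x 0; first by rewrite linear0 !normr0 mulr0.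
have : `|f (`|x|^-1 *: x)| <= opnorm f by rewrite opnorm_ub// normfZV.
by rewrite linearZ /= normrZ normfV normr_id ler_pdivrMl ?normr_gt0// mulrC.
Qed.

Lemma opnorm_le (f : dual) c :
  0 <= c -> (forall x, `|f x| <= c * `|x|) -> opnorm f <= c.
Proof.
move=> c0 fc; have [_ lub] := opnorm_supremums f.
by apply: lub => _ [x x1 <-]; rewrite (le_trans (fc _))// ler_piMr.
Qed.

Let opnormD (f g : dual) : opnorm (f + g) <= opnorm f + opnorm g.
Proof.
apply: opnorm_le => [|x]; first by rewrite addr_ge0 ?opnorm_ge0.
by rewrite dualD mulrDl (le_trans (ler_normD _ _))// lerD ?opnormP.
Qed.

Let opnormZ_le a (f : dual) : opnorm (a *: f) <= `|a| * opnorm f.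
Proof.
apply: opnorm_le => [|x]; first by rewrite mulr_ge0 ?opnorm_ge0.
by rewrite dualZ normrM -mulrA ler_wpM2l ?opnormP.
Qed.

Let opnormZ a (f : dual) : opnorm (a *: f) = `|a| * opnorm f.
Proof.
apply/eqP; rewrite eq_le opnormZ_le/=.
have [->|a0] := eqVneq a 0; first by rewrite normr0 mul0r opnorm_ge0.
rewrite -ler_pdivlMl ?normr_gt0// -normfV.
by rewrite -[f in leLHS](scalerK a0) opnormZ_le.
Qed.

Let opnorm0_eq0 (f : dual) : opnorm f = 0 -> f = 0.
Proof.
move=> f0; apply: dualP => x; apply/eqP; rewrite -normr_le0.
by rewrite (le_trans (opnormP f x))// f0 mul0r.
Qed.

HB.instance Definition _ :=
  Lmodule_isNormed.Build K dual opnormD opnormZ opnorm0_eq0.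

Lemma dual_normE (f : dual) :
  `|f| = supremum 0 [set (`|f x| : K) | x in [set x : X | `|x| <= 1]].
Proof. by []. Qed.

End Dual.
Arguments dual {R k} X.

Section Notions.
Variables (R : realType) (k : scalar_kind).
Local Notation K := (scalar_field R k).

Section Evaluation.
Variable X : normedModType K.

Lemma evaluation_subproof (x : X) :
  (fun f : dual X => f x : K^o) \in @dual_pred R k (dual X).
Proof.
apply/asboolP; have lin : linear (fun f : dual X => f x : K^o) by [].
split=> //.
pose ev := HB.pack_for {linear dual X -> K^o} (fun f : dual X => f x : K^o)
  (GRing.isLinear.Build K (dual X) K^o *:%R _ lin).
apply: (@bounded_linear_continuous _ _ _ ev).
apply/linear_boundedP; exists `|x|; split; first exact: normr_real.
move=> r xr f /=; rewrite mulrC (le_trans (opnormP f x))//.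
by rewrite ler_wpM2l ?opnorm_ge0// ltW.
Qed.

Definition evaluation (x : X) : dual (dual X) :=
  Dual (evaluation_subproof x).

(* The evaluation map is the canonical embedding; reflexivity is about this
   particular map, not about an arbitrary isometry of X onto X^**. *)
Definition reflexive_space : Prop := range evaluation = [set: dual (dual X)].

Definition annihilator (Y : set X) : set (dual X) :=
  [set f | forall y, Y y -> f y = 0].

Definition subspace_set (Y : set X) : Prop :=
  Y 0 /\ forall (a : K) x y, Y x -> Y y -> Y (a *: x + y).

End Evaluation.

Definition l1_direct_sum (X : normedModType K) (U Z : set X) : Prop :=
  [/\ U `&` Z = [set 0],
      forall x, exists u z, [/\ U u, Z z & x = u + z]
    & forall u z, U u -> Z z -> `|u + z| = `|u| + `|z|].

Definition M_ideal (X : normedModType K) (Y : set X) : Prop :=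
  [/\ subspace_set Y, closed Y
    & exists Z : set (dual X),
        subspace_set Z /\ l1_direct_sum (annihilator Y) Z].

Definition M_embedded (X : normedModType K) : Prop :=
  M_ideal (range (@evaluation X)).

(* A norm-preserving linear extension to Y^** is bounded, hence an element of
   the dual of Y^**. *)
Definition Hahn_Banach_smooth (Y : normedModType K) : Prop :=
  forall f : dual Y, exists! F : dual (dual (dual Y)),
    (forall y, F (evaluation y) = f y) /\ `|F| = `|f|.

Definition isometrically_isomorphic (U V : normedModType K) : Prop :=
  exists T : {linear U -> V}, bijective T /\ forall u, `|T u| = `|u|.

End Notions.

(* Main.v *)
(* Since X^*** = X^⊥ ⊕_1 X^*, functionals on X^** split additively.  Choose x0 in
   X^** outside X and f in X^* with x0(f) = 0 and |f| d(x0, X) = 1, and let Y be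
   the subspace { x + f(x) x0 : x in X } of X^**.  A Hahn-Banach extension z + u
   (z in X^*, u in X^⊥) of a functional g on Y agrees on Y with z + u(x0) f,
   and |z + u(x0) f| <= |z| + |u(x0)| |f| <= |z| + |u| = |g|; so restriction to Y
   is an isometry of X^* onto Y^*, and Y^** = X^**.  If u in X^⊥ has u(x0) = 1
   and |u| = 1 / d(x0, X) = |f|, then f and u are distinct norm-preserving
   extensions of f|_Y to Y^**. *)
Require Import Defs.
From HB Require Import structures.
From mathcomp Require Import all_boot all_order all_algebra.
From mathcomp Require Import complex ring.
From mathcomp Require Import all_classical all_reals all_analysis.
Import Order.TTheory GRing.Theory Num.Theory.
Import numFieldNormedType.Exports.

Set Implicit Arguments.
Unset Strict Implicit.
Unset Printing Implicit Defensive.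

Local Open Scope classical_set_scope.
Local Open Scope ring_scope.
Local Open Scope complex_scope.

(** * Dominated extension of real-linear functionals, through graphs *)

(* V is a real vector space through iota, which covers both scalar fields. *)
Section HahnBanachReal.
Variables (R : realType) (K : nzRingType) (iota : {rmorphism R -> K}).
Variables (V : lmodType K) (p : V -> R).
Hypothesis pD : forall x y, p (x + y) <= p x + p y.
Hypothesis pZ : forall (r : R) x, 0 < r -> p (iota r *: x) = r * p x.

Definition linear_graph (G : set (V * R)) :=
  forall r x a y b, G (x, a) -> G (y, b) -> G (iota r *: x + y, r * a + b).

Definition dominated_graph (G : set (V * R)) := forall x a, G (x, a) -> a <= p x.

Let p0 : p 0 = 0.
Proof.
have /eqP := pZ 0 (ltr0Sn R 1); rewrite scaler0 mulr_natl mulr2n.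
by rewrite -subr_eq0 opprD addrA subrr sub0r oppr_eq0 => /eqP.
Qed.

(** Subtracting the two points puts [(0, c - d)] in the graph, and domination by [p 0 = 0] gives
    [c <= d]. Single-valuedness is thus automatic and need not be carried through Zorn's lemma. *)
Lemma linear_graph_fun (G : set (V * R)) x a b :
  linear_graph G -> dominated_graph G -> G (x, a) -> G (x, b) -> a = b.
Proof.
move=> lG dG; suff le y c d : G (y, c) -> G (y, d) -> c <= d.
  by move=> Ga Gb; apply/le_anti/andP; split; exact: (le x).
move=> Gc Gd; have := dG _ _ (lG (-1) _ _ _ _ Gd Gc).
by rewrite rmorphN1 scaleN1r addNr p0 mulN1r addrC subr_le0.
Qed.

(** Extension by one dimension. The value [c] at [v] must satisfy
    [a - p (x - v) <= c <= p (y + v) - b] for all [(x, a)] and [(y, b)] in [G]. Subadditivity makes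
    every left side at most every right side, so [c] is the supremum of the left sides; dividing by
    [|t|] reduces a general coefficient [t] to these two bounds. *)
Lemma graph_step (G : set (V * R)) v :
  G (0, 0) -> linear_graph G -> dominated_graph G ->
  exists c, [set (q.1.1 + iota q.2 *: v, q.1.2 + q.2 * c) | q in G `*` setT]
    `<=` [set q | q.2 <= p q.1].
Proof.
move=> G0 lG dG.
pose A := [set q.2 - p (q.1 - v) | q in G].
have ubA y b : G (y, b) -> ubound A (p (y + v) - b).
  move=> Gy _ [[x a] Gx <-] /=; rewrite lerBrDr addrAC lerBlDr.
  have := dG _ _ (lG 1 _ _ _ _ Gx Gy); rewrite rmorph1 scale1r mul1r.
  move=> /le_trans; apply; rewrite -[x + y](_ : y + v + (x - v) = _) ?pD//.
  by rewrite addrACA subrr addr0 addrC.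
have A0 : A !=set0 by exists (0 - p (0 - v)), (0, 0).
exists (sup A) => _ [[[x a] t] [/= Gx _] <-] /=.
have [t0|t0|->] := ltgtP t 0; last by rewrite rmorph0 scale0r mul0r !addr0 dG.
- pose s := - t; have s0 : 0 < s by rewrite oppr_gt0.
  have Gs := lG s^-1 _ _ _ _ Gx G0; rewrite !addr0 in Gs.
  have := ub_le_sup (ex_intro _ _ (ubA _ _ G0)) (ex_intro2 _ _ _ Gs erefl).
  rewrite /= lerBlDr -(ler_pM2l s0) mulrDr mulrA mulfV ?gt_eqF// mul1r.
  rewrite -pZ// scalerBr scalerA -rmorphM mulfV ?gt_eqF// rmorph1 scale1r.
  by rewrite /s rmorphN scaleNr opprK mulNr addrC lerBrDr.
- have Gt := lG t^-1 _ _ _ _ Gx G0; rewrite !addr0 in Gt.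
  have := ge_sup A0 (ubA _ _ Gt).
  rewrite lerBrDr -(ler_pM2l t0) mulrDr mulrA mulfV ?gt_eqF// mul1r.
  rewrite -pZ// scalerDr scalerA -rmorphM mulfV ?gt_eqF// rmorph1 scale1r.
  by rewrite addrC.
Qed.

Theorem Hahn_Banach_graph (G0 : set (V * R)) :
  G0 (0, 0) -> linear_graph G0 -> dominated_graph G0 ->
  exists h : V -> R,
    [/\ forall r x y, h (iota r *: x + y) = r * h x + h y,
        forall x, h x <= p x & forall x a, G0 (x, a) -> h x = a].
Proof.
move=> G00 lG0 dG0.
(* The union with [G0] makes the empty chain, whose union is empty, admissible. *)
have [|A [[lA dA] Amax]] := @Zorn_bigcup (V * R)
  [set G | linear_graph (G `|` G0) /\ dominated_graph (G `|` G0)].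
  move=> F FP Ftot; split.
    move=> r x a y b [[B FB Bx]|Gx] [[C FC Cy]|Gy].
    - have [BC|CB] := Ftot _ _ FB FC.
        have [l _] := FP _ FC.
        have [h|h] := l r _ _ _ _ (or_introl (BC _ Bx)) (or_introl Cy).
          by left; exists C.
        by right.
      have [l _] := FP _ FB.
      have [h|h] := l r _ _ _ _ (or_introl Bx) (or_introl (CB _ Cy)).
        by left; exists B.
      by right.
    - have [l _] := FP _ FB.
      by have [h|h] := l r _ _ _ _ (or_introl Bx) (or_intror Gy);
        [left; exists B | right].
    - have [l _] := FP _ FC.
      by have [h|h] := l r _ _ _ _ (or_intror Gx) (or_introl Cy);
        [left; exists C | right].
    - by right; exact: lG0.
  move=> x a [[B FB Bx]|]; last exact: dG0.
  by have [_ d] := FP _ FB; apply: d; left.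
set G := A `|` G0 in lA dA.
have GG0 : G (0, 0) by right.
have Gtot v : exists c, G (v, c).
  have [c Gc] := graph_step v GG0 lA dA.
  set G' := [set _ | _ in _] in Gc.
  have GG' : G `<=` G'.
    by move=> [x a] Gx; exists ((x, a), 0) => //=;
      rewrite rmorph0 scale0r mul0r !addr0.
  have G'U : G' `|` G0 = G'.
    by apply/setUidl => q G0q; apply: GG'; right.
  (* Otherwise [G'] would be admissible and strictly larger than [A], as it contains [(v, c)]. *)
  exists c; apply: contrapT => nGc.
  apply: (Amax G').
    split; first by move=> q Aq; apply: GG'; left.
    move=> G'A; apply: nGc; left; apply: G'A.
    by exists ((0, 0), 1) => //=; rewrite rmorph1 scale1r mul1r !add0r.
  rewrite /= G'U; split; last by move=> x a /Gc.
  move=> r _ _ _ _ [[[x a] s] [/= Gx _] [<- <-]] [[[y b] t] [/= Gy _] [<- <-]].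
  exists ((iota r *: x + y, r * a + b), r * s + t); first by split => //; exact: lA.
  rewrite /= rmorphD rmorphM scalerDl -scalerA scalerDr mulrDl mulrDr -mulrA.
  by congr pair; exact: addrACA.
have [h hG] := choice Gtot; exists h; split.
- by move=> r x y; apply: (linear_graph_fun lA dA (hG _)); apply: lA.
- by move=> x; exact: dA.
- by move=> x a G0x; apply: (linear_graph_fun lA dA (hG _)); right.
Qed.

End HahnBanachReal.

(** * Hahn-Banach extension over real and complex scalars *)

Section HahnBanach.
Variables (R : realType) (k : scalar_kind).
Local Notation K := (scalar_field R k).

Lemma dual_exists (V : normedModType K) (F : V -> K^o) (C : K) :
  linear F -> 0 <= C -> (forall x, `|F x| <= C * `|x|) ->
  exists f : dual V, (forall x, f x = F x) /\ `|f| <= C.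
Proof.
move=> lF C0 FC.
suff FP : F \in @dual_pred R k V.
  by exists (Dual FP); split => //; apply: opnorm_le.
apply/asboolP; split=> //.
pose F' := HB.pack_for {linear V -> K^o} F
  (GRing.isLinear.Build K V K^o *:%R _ lF).
apply: (@bounded_linear_continuous _ _ _ F').
apply/linear_boundedP; exists C; split; first exact: ger0_real.
by move=> r Cr x /=; rewrite (le_trans (FC x))// ler_wpM2r// ltW.
Qed.

End HahnBanach.

Lemma linear_bundle (K : nzRingType) (U V : lmodType K) (F : U -> V) :
  linear F -> exists L : {linear U -> V}, L = F :> (U -> V).
Proof.
by move=> lF; exists (HB.pack_for {linear U -> V} F
  (GRing.isLinear.Build K U V *:%R F lF)).
Qed.

(** A functional on a subspace is presented as [g] on [W] with a map [T] into [V]: the bound makes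
    [g] vanish on the kernel of [T], so it descends to the range of [T]. *)
Lemma Hahn_Banach (R : realType) (k : scalar_kind)
    (W : lmodType (scalar_field R k)) (V : normedModType (scalar_field R k))
    (T : W -> V) (g : W -> (scalar_field R k)^o) (C : scalar_field R k) :
  linear T -> linear g -> 0 <= C -> (forall w, `|g w| <= C * `|T w|) ->
  exists f : dual V, (forall w, f (T w) = g w) /\ `|f| <= C.
Proof.
case: k => /= in W V T g C *.
all: move=> /linear_bundle[{}T <-] /linear_bundle[{}g <-] C0 gC.
- pose p (x : V) : R := C * `|x|.
  have [|||||h [lh hp hg]] := @Hahn_Banach_graph R R idfun V p _ _
      [set (T w, g w : R) | w in setT].
  + by move=> x y; rewrite /p -mulrDr ler_wpM2l// ler_normD.
  + by move=> r x r0; rewrite /p normrZ gtr0_norm// mulrCA.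
  + by exists 0 => //; rewrite !linear0.
  + by move=> r _ _ _ _ [w _ [<- <-]] [w' _ [<- <-]]; exists (r *: w + w') => //;
      rewrite !linearP.
  + by move=> _ _ [w _ [<- <-]]; rewrite (le_trans (ler_norm _)).
  (* Since [h] is odd and [p] is even, [h <= p] upgrades to a bound on [|h|]. *)
  have hN x : h (- x) = - h x.
    have h0 : h 0 = 0 by have := lh (-1) 0 0;
      rewrite /= scaler0 addr0 mulN1r addNr.
    by have := lh (-1) x 0; rewrite /= scaleN1r mulN1r !addr0 h0 addr0.
  have [|f [fh fC]] := @dual_exists R RealScalars V h C lh C0.
    move=> x; rewrite ler_norml hp andbT lerNl -hN.
    by rewrite (le_trans (hp _))// /p normrN.
  by exists f; split=> // w; rewrite fh; apply: hg; exists w.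
- pose p (x : V) : R := complex.Re (C * `|x|).
  have ReD (x y : R[i]) : complex.Re (x + y) = complex.Re x + complex.Re y.
    by case: x y => [? ?] [? ?].
  have ReZ r (x : R[i]) : complex.Re (r%:C * x) = r * complex.Re x.
    by case: x => a b /=; rewrite mul0r subr0.
  have Re_le (x y : R[i]) : x <= y -> complex.Re x <= complex.Re y.
    by rewrite lecE => /andP[].
  have Re_le_norm (x : R[i]) : complex.Re x <= complex.Re `|x|.
    by rewrite normc_def/= (le_trans (ler_norm _))// -sqrtr_sqr ler_sqrt
      ?lerDl ?addr_ge0 ?sqr_ge0.
  have [|||||h [lh hp hg]] := @Hahn_Banach_graph R R[i] (real_complex R) V p _ _
      [set (T w, complex.Re (g w)) | w in setT].
  + by move=> x y; rewrite /p -ReD -mulrDr Re_le// ler_wpM2l// ler_normD.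
  + by move=> r x r0; rewrite /p normrZ gtr0_norm ?ltcR// mulrCA ReZ.
  + by exists 0 => //; rewrite !linear0.
  + move=> r _ _ _ _ [w _ [<- <-]] [w' _ [<- <-]].
    by exists (r%:C *: w + w') => //; rewrite !linearP/= ReD ReZ.
  + move=> _ _ [w _ [<- <-]]; rewrite (le_trans (Re_le_norm _))//.
    exact: Re_le.
  have h0 : h 0 = 0.
    by have := lh (-1) 0 0; rewrite /= scaler0 addr0 mulN1r addNr.
  have hD x y : h (x + y) = h x + h y.
    by have := lh 1 x y; rewrite rmorph1 scale1r mul1r.
  have hZ r x : h (r%:C *: x) = r * h x.
    by have := lh r x 0; rewrite h0 !addr0.
  (* The complex-linear functional with real part [h]. *)
  pose F x : R[i] := (h x)%:C - 'i * (h ('i *: x))%:C.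
  have lF : linear F.
    move=> [a b] x y; rewrite /F.
    have -> : (a +i* b) *: x = a%:C *: x + b%:C *: ('i *: x).
      by rewrite scalerA -scalerDl; congr (_ *: _); simpc.
    have -> z : 'i *: (a%:C *: x + b%:C *: ('i *: x) + z) =
        a%:C *: ('i *: x) + (- b)%:C *: x + 'i *: z.
      by rewrite !scalerDr !scalerA; congr (_ *: _ + _ *: _ + _); simpc.
    rewrite !hD !hZ /GRing.scale/=; simpc.
    by congr (_ +i* _); ring.
  have ReF x : complex.Re (F x) = h x.
    by rewrite /F ReD/=; rewrite mul0r mul1r subr0 oppr0 addr0.
  have FC x : `|F x| <= C * `|x|.
    have [->|F0] := eqVneq (F x) 0; first by rewrite normr0 mulr_ge0.
    (* Rotation by the unimodular [t] makes [F (t *: x)] equal to its own real part, which [p]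
       controls. *)
    pose t := `|F x| / F x.
    have t1 : `|t| = 1.
      by rewrite /t normrM normr_id normfV mulfV ?normr_eq0.
    have Ft : F (t *: x) = `|F x|.
      have := lF t x 0; rewrite !addr0.
      have -> : F 0 = 0 by rewrite /F scaler0 h0 mulr0 subr0.
      by rewrite addr0 => ->; rewrite /GRing.scale/= /t mulfVK.
    have := hp (t *: x); rewrite -ReF Ft /p normrZ t1 mul1r => H.
    by rewrite lecE H andbT ger0_Im ?mulr_ge0.
  have [f [fF fC]] := @dual_exists R ComplexScalars V F C lF C0 FC.
  exists f; split=> // w; rewrite fF /F.
  rewrite (hg (T w) (complex.Re (g w))); last by exists w.
  rewrite (hg ('i *: T w) (complex.Re ('i * g w))); last first.
    by exists ('i *: w) => //; rewrite !linearZ.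
  by case: (g w) => a b; simpc.
Qed.

(** * Equivalent renorming along a linear map *)

(* X renormed by |T x|; an alias of X rather than the range of T, so that
   completeness is inherited from X. *)
Section PullbackNorm.
Variables (K : numFieldType) (X : completeNormedModType K) (V : normedModType K).
Variables (T : {linear X -> V}) (c d : K).
Hypotheses (c0 : 0 < c) (d0 : 0 < d).
Hypotheses (Tc : forall x, `|T x| <= c * `|x|) (Td : forall x, `|x| <= d * `|T x|).

(** The bounds are arguments of the alias because the norm and completeness instances attached to it
    are built from them. *)
Definition pullback_space of 0 < c & 0 < d & (forall x, `|T x| <= c * `|x|)
  & (forall x, `|x| <= d * `|T x|) : Type := X.
Local Notation Y := (pullback_space c0 d0 Tc Td).

HB.instance Definition _ := GRing.Lmodule.on Y.

Let normD (x y : Y) : `|T (x + y)| <= `|T x| + `|T y|.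
Proof. by rewrite raddfD ler_normD. Qed.

Let normZ (a : K) (x : Y) : `|T (a *: x)| = `|a| * `|T x|.
Proof. by rewrite linearZ normrZ. Qed.

Let norm_eq0 (x : Y) : `|T x| = 0 -> x = 0.
Proof.
move=> Tx0; apply/eqP; rewrite -(@normr_le0 _ X).
by rewrite (le_trans (Td x))// Tx0 mulr0.
Qed.

HB.instance Definition _ := Lmodule_isNormed.Build K Y normD normZ norm_eq0.

Lemma pullback_complete (F : set_system Y) : ProperFilter F -> cauchy F -> cvg F.
Proof.
move=> FF /cauchy_ballP Fc.
have /cauchy_cvg : cauchy (F : set_system X).
  apply/cauchy_ballP => e e0.
  have [[A B] [/= FA FB] AB] := Fc _ (divr_gt0 e0 d0).
  exists (A, B) => // xy /AB.
  rewrite -!ball_normE /ball_/= => H.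
  by rewrite (le_lt_trans (Td _))// mulrC -ltr_pdivlMr.
move=> /cvg_ex[/= l Fl]; apply/cvg_ex; exists (l : Y).
apply/cvgrPdist_lt => e e0.
have /cvgrPdist_lt/(_ _ (divr_gt0 e0 c0)) := Fl.
apply: filterS => x /= H.
by rewrite (le_lt_trans (Tc _))// mulrC -ltr_pdivlMr.
Qed.

HB.instance Definition _ := Uniform_isComplete.Build Y pullback_complete.

End PullbackNorm.

(** * Canonical embeddings and the splitting of the third dual *)

Section DualFacts.
Variables (R : realType) (k : scalar_kind).
Local Notation K := (scalar_field R k).
Implicit Types X : normedModType K.

Lemma dual_normP X (f : dual X) x : `|f x| <= `|f| * `|x|.
Proof. exact: opnormP. Qed.

Lemma dual_norm_le X (f : dual X) (c : K) :
  0 <= c -> (forall x, `|f x| <= c * `|x|) -> `|f| <= c.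
Proof. exact: opnorm_le. Qed.

Lemma dual_addZ X (f : dual X) (a : K) (x y : X) : f (x + a *: y) = f x + a * f y.
Proof. by rewrite [x + _]addrC linearP addrC. Qed.

Lemma dual_scale X (f : dual X) (a : K) (x : X) : f (a *: x) = a * f x.
Proof. by rewrite linearZ. Qed.

Lemma evaluationP X (a : K) (x y : X) :
  evaluation (a *: x + y) = a *: evaluation x + evaluation y.
Proof. by apply: dualP => f; rewrite dualD dualZ /= linearP. Qed.

Lemma evaluation0 X : evaluation (0 : X) = 0.
Proof. by apply: dualP => f; rewrite /= linear0. Qed.

Lemma evaluationZ X (a : K) (x : X) : evaluation (a *: x) = a *: evaluation x.
Proof. by rewrite -[a *: x]addr0 evaluationP evaluation0 addr0. Qed.

(** The lower bound needs a norming functional, obtained by extending [t *: x |-> t * |x|] from the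
    line through [x]. *)
Lemma norm_evaluation X (x : X) : `|evaluation x| = `|x|.
Proof.
apply/le_anti/andP; split.
  by apply: dual_norm_le => // f; rewrite [leRHS]mulrC; exact: (dual_normP f x).
have [||||f [fx f1]] := @Hahn_Banach R k K^o X (fun t => t *: x)
    (fun t => t * `|x|) 1.
- by move=> a s t; rewrite scalerDl scalerA.
- by move=> a s t; rewrite mulrDl -mulrA.
- by [].
- by move=> t; rewrite mul1r normrM normr_id normrZ.
have := fx 1; rewrite scale1r mul1r => {}fx.
have := dual_normP (evaluation x) f; rewrite /= fx normr_id.
by move=> /le_trans; apply; rewrite ler_piMr.
Qed.

Lemma dual_comp X (V : normedModType K) (T : V -> X) (c : K) (f : dual X) :
  linear T -> 0 <= c -> (forall x, `|T x| <= c * `|x|) ->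
  exists g : dual V, (forall x, g x = f (T x)) /\ `|g| <= `|f| * c.
Proof.
move=> lT c0 Tc; apply: dual_exists; first by move=> a x y; rewrite lT linearP.
  exact: mulr_ge0.
by move=> x; rewrite (le_trans (dual_normP _ _))// -mulrA ler_wpM2l.
Qed.

(* The complement Z given by M-ideality is not assumed to be the canonical copy
   of X^*; it contains it because the X^⊥-component of evaluation z must
   vanish: the Z-component already has the same restriction to X. *)
Lemma M_embedded_decomposition X : M_embedded X ->
  forall F : dual (dual (dual X)), exists (z : dual X) u,
    [/\ annihilator (range (@evaluation _ _ X)) u, F = evaluation z + u
      & `|F| = `|z| + `|u|].
Proof.
move=> [_ _ [Z [[_ _] [_ dec add]]]] F.
have canZ (z : dual X) : Z (evaluation z).
  have [u [w [Uu Zw Ew]]] := dec (evaluation z).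
  suff u0 : u = 0 by rewrite Ew u0 add0r.
  apply/eqP; rewrite -normr_le0.
  (* As [w] restricts to [z] on X, its norm is at least [|z|]; with [|z| = |u| + |w|] this forces
     [u = 0]. *)
  have : `|evaluation z| <= `|w|.
    rewrite norm_evaluation; apply: dual_norm_le => // x.
    have -> : z x = w (evaluation x).
      have : evaluation z (evaluation x) = (u + w) (evaluation x) by rewrite Ew.
      by rewrite dualD Uu ?add0r//; exists x.
    by rewrite (le_trans (dual_normP _ _))// norm_evaluation.
  by rewrite Ew add// gerDr.
have [|||z [zF _]] := @dual_comp _ X (@evaluation _ _ X) 1 F.
- by move=> a x y; exact: evaluationP.
- exact: ler01.
- by move=> x; rewrite norm_evaluation mul1r.
exists z, (F - evaluation z).
have Uu : annihilator (range (@evaluation _ _ X)) (F - evaluation z).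
  by move=> _ [x _ <-]; rewrite -[LHS]/(F (evaluation x) - z x) zF subrr.
split=> //; first by rewrite addrC subrK.
by rewrite -(norm_evaluation z) addrC -add// subrK.
Qed.

End DualFacts.

(** * The perturbed predual, its dual, and two extensions of one functional *)

Section PerturbedPredual.
Variables (R : realType) (k : scalar_kind).
Local Notation K := (scalar_field R k).
Variables (X : completeNormedModType K) (f : dual X) (x0 : dual (dual X)).
Hypothesis x0f : x0 f = 0.

Definition perturbed_embedding (x : X) : dual (dual X) :=
  evaluation x + f x *: x0.
Local Notation T := perturbed_embedding.

Lemma perturbed_embedding_linear : linear T.
Proof.
move=> a x y; rewrite /T evaluationP linearP scalerDl scalerDr scalerA.
by rewrite addrACA.
Qed.

HB.instance Definition _ :=
  GRing.isLinear.Build K X (dual (dual X)) *:%R T perturbed_embedding_linear.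

Lemma perturbed_embeddingE x z : T x z = z x + f x * x0 z.
Proof. by []. Qed.

(** Since [x0 f = 0], a multiple of [f] added to [z] contributes only [a * f x]; this is how the
    annihilator part of an extension is absorbed into [X^*]. *)
Lemma perturbed_embedding_shift x z a : T x (z + a *: f) = T x z + a * f x.
Proof.
rewrite !perturbed_embeddingE dualD dualZ dual_addZ x0f.
by rewrite mulr0 addr0 addrAC.
Qed.

(** The hypothesis makes [z - z'] a multiple of [f] with coefficient [x0 z' - x0 z]; applying [x0],
    which kills [f], shows that this coefficient is 0. *)
Lemma perturbed_embedding_inj z z' : (forall x, T x z = T x z') -> z = z'.
Proof.
move=> Tzz'; have x0z : z = z' + (x0 z' - x0 z) *: f.
  apply: dualP => x; have := Tzz' x.
  rewrite !perturbed_embeddingE dualD dualZ => /(canRL (addrK _)) ->.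
  by rewrite mulrBl ![f x * _]mulrC addrA.
have : x0 z = x0 z' by rewrite [in LHS]x0z dual_addZ x0f mulr0 addr0.
by move=> e; rewrite x0z e subrr scale0r addr0.
Qed.

Lemma annihilator_perturbed_embedding (u : dual (dual (dual X))) x :
  annihilator (range (@evaluation _ _ X)) u -> u (T x) = f x * u x0.
Proof. by move=> Uu; rewrite /T dual_addZ (Uu (evaluation x)) ?add0r//; exists x. Qed.

Let c : K := 1 + `|f| * `|x0|.
Let c0 : 0 < c. Proof. by rewrite ltr_pwDl// mulr_ge0. Qed.

Lemma norm_perturbed_embedding_le x : `|T x| <= c * `|x|.
Proof.
rewrite (le_trans (ler_normD _ _))// norm_evaluation mulrDl mul1r lerD2l.
by rewrite normrZ mulrAC ler_wpM2r// dual_normP.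
Qed.

(** The value [z x] is recovered from [T x] by testing it on [z - x0(z) f], whose norm is at most
    [c * |z|]. *)
Lemma norm_le_perturbed_embedding x : `|x| <= c * `|T x|.
Proof.
rewrite -norm_evaluation; apply: dual_norm_le => [|z].
  by rewrite mulr_ge0// ltW.
have -> : evaluation x z = T x (z + (- x0 z) *: f).
  by rewrite perturbed_embedding_shift perturbed_embeddingE /=; ring.
rewrite (le_trans (dual_normP _ _))// mulrAC [leRHS]mulrC ler_wpM2l//.
rewrite (le_trans (ler_normD _ _))// /c mulrDl mul1r lerD2l.
by rewrite normrZ normrN mulrC -mulrA ler_wpM2l// dual_normP.
Qed.

Definition perturbed_predual : completeNormedModType K :=
  pullback_space c0 c0 norm_perturbed_embedding_le norm_le_perturbed_embedding.
Local Notation Y := perturbed_predual.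

Hypothesis Mdec : M_embedded X.
Hypothesis x0_dist : forall u : dual (dual (dual X)),
  annihilator (range (@evaluation _ _ X)) u -> `|u x0| * `|f| <= `|u|.

Lemma perturbed_dual_rep (g : dual Y) :
  exists z : dual X, (forall y : Y, g y = T y z) /\ `|z| = `|g|.
Proof.
have [||||F [FT Fg]] := @Hahn_Banach R k X (dual (dual X)) T g `|g|.
- exact: perturbed_embedding_linear.
- exact: (@dual_linear _ _ Y g).
- by [].
- by move=> y; rewrite (dual_normP g y).
have [z [u [Uu Fzu nF]]] := M_embedded_decomposition Mdec F.
exists (z + (u x0) *: f).
have gT (y : Y) : g y = T y (z + u x0 *: f).
  rewrite perturbed_embedding_shift -FT Fzu dualD /=.
  by rewrite annihilator_perturbed_embedding// [f y * _]mulrC.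
split=> //; apply/le_anti/andP; split.
  rewrite (le_trans _ Fg)// nF (le_trans (ler_normD _ _))// lerD2l normrZ.
  exact: x0_dist.
apply: dual_norm_le => // y; rewrite gT mulrC.
exact: (dual_normP (T y) _).
Qed.

(** The functional has some representative of the same norm by [perturbed_dual_rep], and injectivity
    identifies that representative with [z]. *)
Lemma perturbed_dual_functional (z : dual X) :
  exists g : dual Y, (forall y : Y, g y = T y z) /\ `|g| = `|z|.
Proof.
have [|||g [gT _]] := @dual_exists R k Y (fun y => T y z) `|z|.
- by move=> a x y; rewrite linearP.
- by [].
- by move=> y; rewrite mulrC; exact: (dual_normP (T y) _).
exists g; split => //; have [z' [gz' <-]] := perturbed_dual_rep g.
by congr `|_|; apply: perturbed_embedding_inj => x; rewrite -gT gz'.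
Qed.

Lemma perturbed_dual_isometry : isometrically_isomorphic (dual Y) (dual X).
Proof.
have [P /all_and2[PT nP]] := choice perturbed_dual_rep.
have [Q /all_and2[QT _]] := choice perturbed_dual_functional.
have lP : linear P.
  move=> a g h; apply: perturbed_embedding_inj => x.
  by rewrite -PT dualD dualZ !PT linearP.
have [L LP] := linear_bundle lP; exists L; rewrite LP; split=> //; exists Q.
  by move=> g; apply: dualP => y; rewrite QT PT.
by move=> z; apply: perturbed_embedding_inj => y; rewrite -PT QT.
Qed.

Hypothesis f0 : f != 0.
Hypothesis x0_attained : exists u : dual (dual (dual X)),
  [/\ annihilator (range (@evaluation _ _ X)) u, u x0 = 1 & `|u| <= `|f|].

Lemma perturbed_predual_not_smooth : ~ Hahn_Banach_smooth Y.
Proof.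
move=> smooth; have [u [Uu ux0 nu]] := x0_attained.
have [P /all_and2[PT nP]] := choice perturbed_dual_rep.
have [Q /all_and2[QT nQ]] := choice perturbed_dual_functional.
have PQ z : P (Q z) = z.
  by apply: perturbed_embedding_inj => y; rewrite -PT QT.
have lP : linear P.
  move=> a g h; apply: perturbed_embedding_inj => x.
  by rewrite -PT dualD dualZ !PT linearP.
have lQ : linear Q.
  by move=> a g h; apply: dualP => y; rewrite dualD dualZ !QT linearP.
(* The adjoint of [Q] maps [Y^**] to [X^**] without increasing norms and sends [evaluation y] to
   [T y]. *)
have adj (G : dual (dual Y)) : exists H : dual (dual X),
    (forall z, H z = G (Q z)) /\ `|H| <= `|G| * 1.
  apply: dual_comp => //.
  by move=> z; rewrite nQ mul1r.
have [A /all_and2[AQ nA]] := choice adj.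
have lA : linear A.
  by move=> a G H; apply: dualP => z; rewrite dualD dualZ !AQ dualD dualZ.
(* Composition with [A] turns a suitable functional on [X^**] into a norm-preserving extension of
   [Q f], which is [f] read as a functional on [Y]. *)
have lift (F : dual (dual (dual X))) : `|F| <= `|f| ->
    (forall x, F (T x) = f x) -> exists F' : dual (dual (dual Y)),
    [/\ forall G, F' G = F (A G), forall y, F' (evaluation y) = Q f y
      & `|F'| = `|Q f|].
  move=> Ff FT.
  have [||F' [F'A nF']] := @dual_comp _ _ _ _ A 1 F lA.
  - exact: ler01.
  - by move=> G; rewrite mul1r -[leRHS]mulr1.
  have F'ev y : F' (evaluation y) = Q f y.
    rewrite F'A QT perturbed_embeddingE x0f mulr0 addr0 -FT; congr (F _).
    by apply: dualP => z; rewrite AQ /= QT.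
  exists F'; split=> //; apply/le_anti/andP; split.
    by rewrite nQ (le_trans nF')// mulr1.
  apply: dual_norm_le => // y; rewrite -F'ev -[`|y|]norm_evaluation.
  exact: dual_normP.
have [|x|F1 [F1A F1ev nF1]] := lift (evaluation f).
- by rewrite norm_evaluation.
- by rewrite -[LHS]/(T x f) perturbed_embeddingE x0f mulr0 addr0.
have [//|x|F2 [F2A F2ev nF2]] := lift u.
  by rewrite annihilator_perturbed_embedding// ux0 mulr1.
have [F [_ Funiq]] := smooth (Q f).
have F12 : F1 = F2 by rewrite -(Funiq F1)// (Funiq F2).
move/eqP: f0; apply; apply: dualP => x.
(* This [G] satisfies [A G = evaluation x]; there [F1] takes the value [f x] and [F2] the value 0,
   so their equality would give [f = 0]. *)
have [||G [GP _]] := @dual_comp _ _ _ _ P 1 (evaluation x) lP.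
- exact: ler01.
- by move=> g; rewrite nP mul1r.
have AG : A G = evaluation x.
  by apply: dualP => z; rewrite AQ GP PQ.
have := F1A G; rewrite F12 F2A AG Uu; last by exists x.
exact: esym.
Qed.

End PerturbedPredual.

(** * Distance from a bidual element to X, and its dual description *)

Section Distance.
Variables (R : realType) (k : scalar_kind).
Local Notation K := (scalar_field R k).

(** The distance is taken as the supremum of the nonnegative lower bounds, since suprema of
    nonnegative sets exist in [K] for both kinds of scalars. It is positive because a ball around
    [v] misses the closed set [M]. *)
Lemma distance_exists (V : normedModType K) (M : set V) (v : V) :
  M !=set0 -> closed M -> ~ M v ->
  exists2 d : K, 0 < d & (forall m, M m -> d <= `|v - m|) /\
    forall r, 0 <= r -> (forall m, M m -> r <= `|v - m|) -> r <= d.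
Proof.
move=> [m0 Mm0] Mclosed Mv.
pose A : set K := [set r | 0 <= r /\ forall m, M m -> r <= `|v - m|].
have [|||d [Ad dA]] := @scalar_supremums R k A.
- by exists 0; split.
- by exists `|v - m0| => r [_]; apply.
- by move=> r [].
have /nbhs_ballP[e /= e0 eM] : nbhs v (~` M).
  by apply: open_nbhs_nbhs; split => //; rewrite openC.
exists d; last first.
  split=> [m Mm|r r0 rM]; last by apply: Ad; split.
  by apply: dA => r [_]; apply.
apply: (lt_le_trans e0); apply: Ad; split=> [|m Mm]; first exact: ltW.
rewrite real_leNgt ?(gtr0_real e0) ?normr_real//.
by apply/negP => vm; apply: (eM m) => //; rewrite -ball_normE.
Qed.

Variable X : normedModType K.
Variables (x0 : dual (dual X)) (d : K).
Hypothesis d0 : 0 < d.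

(** Since [u] vanishes on X, [|u x0| / |u|] is a lower bound of all [|x0 - evaluation x|]. *)
Lemma annihilator_distance_le (u : dual (dual (dual X))) :
  (forall r, 0 <= r -> (forall x : X, r <= `|x0 - evaluation x|) -> r <= d) ->
  annihilator (range (@evaluation _ _ X)) u -> `|u x0| <= d * `|u|.
Proof.
move=> dmax Uu; have [u0|u0] := eqVneq `|u| 0.
  by rewrite (le_trans (dual_normP _ _))// u0 mul0r mulr0.
have {}u0 : 0 < `|u| by rewrite lt_def u0 /=.
rewrite -ler_pdivrMr//; apply: dmax => [|x]; first by rewrite divr_ge0.
rewrite ler_pdivrMr// mulrC (le_trans _ (dual_normP _ _))//.
have Uux : u (evaluation x) = 0 by apply: Uu; exists x.
by rewrite -scaleN1r dual_addZ Uux mulr0 addr0.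
Qed.

(** Hahn-Banach extends [x + t x0 |-> t] from the span of X and [x0]; for nonzero [t],
    [|x + t x0| = |t| |x0 - (- x / t)|] is at least [|t| d]. *)
Lemma annihilator_distance_attained :
  (forall x : X, d <= `|x0 - evaluation x|) ->
  exists u : dual (dual (dual X)),
    [/\ annihilator (range (@evaluation _ _ X)) u, u x0 = 1 & `|u| <= d^-1].
Proof.
move=> dmin.
have [|||w|u [uT nu]] := @Hahn_Banach R k (X * K^o)%type (dual (dual X))
  (fun w => evaluation w.1 + w.2 *: x0) (fun w => w.2) d^-1.
- move=> a [x s] [y t] /=; rewrite evaluationP scalerDl scalerDr scalerA.
  by rewrite addrACA.
- by [].
- by rewrite invr_ge0 ltW.
- rewrite ler_pdivlMl//; case: w => x t /=.
  have [->|t0] := eqVneq t 0; first by rewrite normr0 mulr0.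
  rewrite (_ : evaluation x + t *: x0 = t *: (x0 - evaluation ((- t^-1) *: x))).
    by rewrite normrZ mulrC ler_wpM2l ?dmin.
  by rewrite evaluationZ scaleNr opprK scalerDr scalerA mulfV// scale1r addrC.
exists u; split=> //.
  by move=> _ [x _ <-]; have := uT (x, 0); rewrite /= scale0r addr0.
by have := uT (0, 1); rewrite /= scale1r evaluation0 add0r.
Qed.

End Distance.

(** * Choice of [x0] and [f] for a nonreflexive space *)

Theorem theorem5p1 (R : realType) (k : scalar_kind)
  (X : completeNormedModType (scalar_field R k)) :
  ~ reflexive_space X -> M_embedded X ->
  exists Y : completeNormedModType (scalar_field R k),
    isometrically_isomorphic (dual Y) (dual X) /\ ~ Hahn_Banach_smooth Y.
Proof.
move=> nrefl Xemb; have [_ clX _] := Xemb.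
have [x1 x1X] : exists x1, ~ range (@evaluation _ _ X) x1.
  apply: contrapT => /forallNP allX; apply: nrefl; apply/seteqP; split=> // F _.
  exact: contrapT (allX F).
have [f1 f1N0] : exists f1 : dual X, f1 != 0.
  apply: contrapT => /forallNP f0; apply: x1X; exists 0 => //; apply: dualP => f.
  by have /negP/negPn/eqP -> := f0 f; rewrite !raddf0.
have [x f1x] : exists x, f1 x != 0.
  apply: contrapT => /forallNP fx0; move/eqP: f1N0; apply; apply: dualP => x.
  by have /negP/negPn/eqP -> := fx0 x.
(* Subtracting an element of X keeps the point outside X; this one is chosen to make [x0 f1 = 0]. *)
pose x0 := x1 - evaluation ((x1 f1 / f1 x) *: x).
have x0f1 : x0 f1 = 0.
  by rewrite -[LHS]/(x1 f1 - f1 ((x1 f1 / f1 x) *: x)) dual_scale divfK//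
    subrr.
have x0X : ~ range (@evaluation _ _ X) x0.
  move=> [y _ yx0]; apply: x1X; exists ((x1 f1 / f1 x) *: x + y) => //.
  by rewrite evaluationP yx0 /x0 evaluationZ addrC subrK.
have [|d d0 [dmin dmax]] := distance_exists _ clX x0X.
  by exists (evaluation 0), 0.
have f1_gt0 : 0 < `|f1| by rewrite normr_gt0.
(* The scaling gives [|f| = d^-1], at which both the distance bound and its attainment hold. *)
pose f := (d * `|f1|)^-1 *: f1.
have nf : `|f| = d^-1.
  rewrite /f normrZ gtr0_norm ?invr_gt0 ?mulr_gt0// invfM -mulrA mulVf ?mulr1//.
  by rewrite gt_eqF.
have x0f : x0 f = 0 by rewrite /f dual_scale x0f1 mulr0.
have x0_dist u : annihilator (range (@evaluation _ _ X)) u ->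
    `|u x0| * `|f| <= `|u|.
  move=> Uu; rewrite nf ler_pdivrMr// mulrC.
  apply: annihilator_distance_le => // r r0 rX; apply: dmax => // _ [y _ <-].
  exact: rX.
exists (perturbed_predual x0f); split; first exact: perturbed_dual_isometry.
apply: perturbed_predual_not_smooth => //.
- by rewrite -normr_gt0 nf invr_gt0.
- rewrite nf; apply: annihilator_distance_attained => // y.
  by apply: dmin; exists y.
Qed.
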